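(* Let $p_1,\dots,p_d\in(0,1)$ with $\sum_{k=1}^dp_k=1$. Sample tasks $h_1,h_2,\dots$ independently as follows: draw $k\in[d]$ with $\Pr[k=i]=p_i$, then draw $h'$ uniformly from $\mathcal{F}^d_k$ and set the task to $h'\circ\psi^{-1}$. Consider representations $\Phi:\{-1,1\}^m\to\mathcal{Z}$ for which $T_\Phi:=\Phi\circ\psi$ is a bijection of $\mathcal{Z}$ (these are exactly the representations for which, for every possible task sequence, functions $g_i:\mathcal{Z}\to\mathbb{R}$ with $g_i\circ\Phi\in\mathcal{H}(h_i)$ exist; such $g_i$ are then unique). For such $\Phi$ consider the objective $\frac1n\widehat{\deg}(g\circ\Phi)=\frac1n\big(\sum_{i=1}^n\deg(g_i)+\sum_{j=1}^d\deg(\Phi_j)\big)$ of the problem $\min_{\Phi,g}\frac1n\widehat{\deg}(g\circ\Phi)$ subject to $g_i\circ\Phi\in\mathcal{H}(h_i)$ for all $i\in[n]$. Then, almost surely, as $n\to\infty$ this objective converges for every such $\Phi$, and every $\Phi^*$ minimizing the limit learns the world model up to negations and permutations: there exist a permutation $i_1,\dots,i_d$ of $1,\dots,d$ and signs $s_1,\dots,s_d\in\{-1,1\}$ such that $\Phi^*_j(\psi(z))=s_jz_{i_j}$ for every $j\in[d]$ and every $z\in\mathcal{Z}$.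
   Context: Standing setup: integers $m\ge d\ge 1$, $\mathcal{Z}=\{-1,1\}^d$, $\psi:\mathcal{Z}\to\{-1,1\}^m$ injective, $\mathcal{X}:=\psi(\mathcal{Z})$, latent distribution with full support. For $f:\{-1,1\}^n\to\mathbb{R}$, $f=\sum_{S\subseteq[n]}\hat f(S)\chi_S$, $\chi_S(x)=\prod_{i\in S}x_i$, $\deg(f)=\max\{|S|:\hat f(S)\ne0\}$ (0 for constants). $\mathcal{H}(h)$ is the set of $f:\{-1,1\}^m\to\mathbb{R}$ agreeing with the task $h$ on $\mathcal{X}$. Finite-precision convention: fix a finite $V\subset\mathbb{R}$ with $\{-1,1\}\subseteq V$; $\mathcal{F}^d$ is the set of all functions $\{-1,1\}^d\to V$ and $\mathcal{F}^d_k:=\{h\in\mathcal{F}^d:\deg(h)\le k\}$ (a $k$-degree task is one of the form $h'\circ\psi^{-1}$ with $h'\in\mathcal{F}^d_k$). *)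

(* Defs.v *)
From HB Require Import structures.
From mathcomp Require Import all_boot all_order all_algebra perm.
From mathcomp Require Import all_classical all_reals all_analysis.
Set Implicit Arguments. Unset Strict Implicit. Unset Printing Implicit Defensive.
Import Order.TTheory GRing.Theory Num.Theory numFieldNormedType.Exports.
Local Open Scope classical_set_scope.
Local Open Scope ring_scope.

(* The hypercube {-1,1}^n, encoded as bool-valued finite functions:
   the coordinate x_i is the real number sgnb (x i) (true = -1, false = 1). *)
Definition cube (n : nat) := {ffun 'I_n -> bool}.

Definition sgnb {R : numDomainType} (b : bool) : R := if b then -1 else 1.

Definition chi {R : numDomainType} (n : nat) (S : {set 'I_n}) (x : cube n) : R :=
  \prod_(i in S) sgnb (x i).

(* Fourier coefficient hat f(S) = 2^{-n} sum_x f(x) chi_S(x)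
   (the unique coefficients with f = sum_S hat f(S) chi_S). *)
Definition fcoef {R : numFieldType} (n : nat) (f : cube n -> R) (S : {set 'I_n}) : R :=
  (2 ^+ n)^-1 * \sum_(x : cube n) f x * chi S x.

(* deg f = max {|S| : hat f(S) <> 0}, and 0 for f = 0 *)
Definition fdeg {R : numFieldType} (n : nat) (f : cube n -> R) : nat :=
  \max_(S : {set 'I_n} | fcoef f S != 0) #|S|.

Definition Ftask {R : realType} (V : seq R) (d : nat) := {ffun cube d -> seq_sub V}.

Definition Fk {R : realType} (V : seq R) (d k : nat) : {set Ftask V d} :=
  [set h : Ftask V d | (fdeg (fun z => val (h z)) <= k)%N].

(* Law of one task (k, h'): k in [d] (index kk : 'I_d stands for k = kk+1)
   with probability p kk, then h' uniform on F^d_k. *)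
Definition taskpmf {R : realType} (V : seq R) (d : nat) (p : 'I_d -> R)
  (t : 'I_d * Ftask V d) : R :=
  p t.1 * (if t.2 \in Fk V d t.1.+1 then (#|Fk V d t.1.+1|%:R)^-1 else 0).

Definition iid_with_pmf {disp : measure_display} {T : measurableType disp}
  {R : realType} {A : finType} (P : probability T R) (X : nat -> T -> A)
  (pmf : A -> R) : Prop :=
  (forall i a, measurable (X i @^-1` [set a])) /\
  (forall (I : seq nat) (a : nat -> A), uniq I ->
     P (\bigcap_(i in [set j | j \in I]) (X i @^-1` [set a i]))
     = (\prod_(i <- I) pmf (a i))%:E).

Definition valid_rep (m d : nat) (psi : cube d -> cube m) (Phi : cube m -> cube d) : Prop :=
  bijective (fun z => Phi (psi z)).

Definition objective {R : realType} (m d : nat) (n : nat) (Phi : cube m -> cube d)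
  (g : nat -> cube d -> R) : R :=
  (n%:R)^-1 * (\sum_(i < n) (fdeg (g i))%:R
               + \sum_(j < d) (fdeg (fun x => sgnb (R:=R) (Phi x j)))%:R).

(* Main.v *)
(* The law of large numbers for finitely valued i.i.d. sequences shows that the
   objective of Phi converges almost surely to the mean of deg (h o T^-1),
   T = Phi o psi, for a random task h.  For each k, the functions h o T^-1 with h
   in F_k form a set of #|F_k| functions, and F_k consists of the functions of
   least degree, so this mean is at least the one for T = id; equality at k = 1
   forces F_1 to be stable under composition with T^-1.  The coordinates lie in
   F_1, hence every coordinate of T has degree at most 1; a {-1,1}-valued function
   of degree at most 1 is a constant or a signed coordinate, and since T is
   bijective these signed coordinates are distinct and non constant. *)
Require Import Defs.
From HB Require Import structures.
From mathcomp Require Import all_boot all_order all_algebra perm.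
From mathcomp Require Import all_classical all_reals all_analysis.
From mathcomp Require Import ring lra.
Import Order.TTheory GRing.Theory Num.Theory numFieldNormedType.Exports.
Local Open Scope ring_scope.

(** * Rearrangement of degree sums under an injection *)

(** As [A] and its image [B] have equal size, [A :\: B] and [B :\: A] do too. Exchanging the first
    for the second replaces degrees at most [k] by degrees at least [k + 1], a gain of at least one
    per element. *)
Lemma sum_leq_sum_inj (U : finType) (deg : U -> nat) (phi : U -> U) (k : nat)
    (A : {set U}) :
  injective phi -> (forall h, (h \in A) = (deg h <= k)%N) ->
  (\sum_(h in A) deg h + #|phi @: A :\: A| <= \sum_(h in A) deg (phi h))%N.
Proof.
move=> phiI AE; rewrite -(big_imset deg (in2W phiI)) /=.
set B := phi @: A.
have cAB : #|A :\: B| = #|B :\: A|.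
  by rewrite !cardsD (card_imset _ phiI) finset.setIC.
rewrite (big_setID B) [in leqRHS](big_setID A) /= (finset.setIC B) -addnA leq_add2l.
apply: (@leq_trans (k * #|A :\: B| + #|B :\: A|)).
  rewrite leq_add2r mulnC -sum_nat_const; apply: leq_sum => h.
  by rewrite inE AE => /andP[].
rewrite cAB addnC -mulSn mulnC -sum_nat_const; apply: leq_sum => h.
by rewrite inE AE -ltnNge => /andP[].
Qed.

(** * Fourier analysis on the cube *)

Section fourier.
Context {R : numFieldType} {n : nat}.
Implicit Types (x y z : cube n) (S : {set 'I_n}) (f : cube n -> R).

Lemma sgnbM (b : bool) : sgnb b * sgnb b = 1 :> R.
Proof. by case: b; rewrite /sgnb ?mulrNN mulr1. Qed.

Lemma chi_prod S x : chi S x = \prod_i (if i \in S then sgnb (x i) else 1) :> R.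
Proof. by rewrite /chi big_mkcond. Qed.

(** The sum over [S] expands a product of factors [x_i y_i + 1], which are 2 where [x] and [y] agree
    and 0 where they differ. *)
Lemma sum_chiM x y : \sum_S chi S x * chi S y = (if x == y then 2 ^+ n else 0) :> R.
Proof.
transitivity (\prod_(i < n) (sgnb (x i) * sgnb (y i) + 1) : R).
  rewrite bigA_distr /=; apply: eq_bigr => S _.
  by rewrite !chi_prod -big_split; apply: eq_bigr => i _ /=; case: ifP; rewrite ?mulr1.
case: eqP => [->|/eqP xy].
  by under eq_bigr do rewrite sgnbM; rewrite prodr_const card_ord.
have [i xi] : exists i, x i != y i.
  apply/existsP; rewrite -negb_forall; apply: contra xy => /forallP xy.
  by apply/eqP/ffunP => i; apply/eqP.
rewrite (bigD1 i) //=; move: xi.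
by case: (x i); case: (y i) => //; rewrite /sgnb ?mulr1 ?mul1r addNr mul0r.
Qed.

Lemma fourier_inversion f x : f x = \sum_S fcoef f S * chi S x.
Proof.
transitivity ((2 ^+ n)^-1 * \sum_y f y * \sum_S chi S y * chi S x).
  under eq_bigr do rewrite sum_chiM.
  rewrite (bigD1 x) //= eqxx big1 ?addr0 => [|y /negbTE ->]; last by rewrite mulr0.
  by rewrite mulrC mulfK // expf_neq0 // pnatr_eq0.
under eq_bigr do rewrite mulr_sumr.
rewrite exchange_big mulr_sumr; apply: eq_bigr => S _.
by rewrite /fcoef -mulrA mulr_suml; congr (_ * _); apply: eq_bigr => y _; rewrite mulrA.
Qed.

(** The sum over the cube factors over the coordinates; one in the symmetric difference of [S] and
    [S'] contributes [1 + (-1) = 0]. *)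
Lemma fcoef_chi S S' : S != S' -> fcoef (chi S') S = 0 :> R.
Proof.
move=> SS'; rewrite /fcoef.
have [i Si] : exists i, (i \in S) != (i \in S').
  apply/existsP; rewrite -negb_forall; apply: contra SS' => /forallP SS'.
  by apply/eqP/finset.setP => i; apply/eqP.
transitivity ((2 ^+ n)^-1 * \prod_(i < n) \sum_(b : bool)
    ((if i \in S' then sgnb b else 1) * (if i \in S then sgnb b else 1)) : R).
  rewrite bigA_distr_bigA /=; congr (_ * _); apply: eq_bigr => x _.
  by rewrite !chi_prod big_split.
rewrite (bigD1 i) //= big_bool; move: Si.
case: (i \in S); case: (i \in S') => //= _;
  by rewrite /sgnb ?mulr1 ?mul1r addNr mul0r mulr0.
Qed.

Lemma fdeg_coord i : (fdeg (fun x => sgnb (x i) : R) <= 1)%N.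
Proof.
rewrite (_ : (fun x => _) = chi [set i]); last first.
  by apply/funext => x; rewrite /chi big_set1.
apply/bigmax_leqP => S; have [->|/fcoef_chi ->] := eqVneq S [set i].
  by rewrite cards1.
by rewrite eqxx.
Qed.

Definition flip (j : 'I_n) x : cube n := [ffun i => (i == j) (+) x i].

Lemma flip_same j x : sgnb (flip j x j) = - sgnb (x j) :> R.
Proof. by rewrite ffunE eqxx; case: (x j); rewrite /= ?opprK. Qed.

Lemma flip_other j i x : i != j -> flip j x i = x i.
Proof. by rewrite ffunE => /negbTE ->. Qed.

Lemma chi_flip S j x : chi S (flip j x) = (if j \in S then -1 else 1) * chi S x :> R.
Proof.
case: ifP => jS; last first.
  rewrite mul1r; apply: eq_bigr => i iS.
  by rewrite flip_other //; apply: contraFneq jS => <-.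
rewrite /chi (bigD1 j) //= [in RHS](bigD1 j) //= flip_same mulrA mulN1r.
by congr (_ * _); apply: eq_bigr => i /andP[_ ij]; rewrite flip_other.
Qed.

Lemma fcoef_gt_deg f S : (fdeg f < #|S|)%N -> fcoef f S = 0.
Proof.
rewrite ltnNge => h; apply/eqP; apply: contraNT h => S0.
exact: (@leq_bigmax_cond _ (fun S => fcoef f S != 0) (fun S : {set 'I_n} => #|S|)).
Qed.

(** Flipping [j] cancels every character without [j], and in degree at most 1 the only character
    with [j] is that of [[set j]]. *)
Lemma fdeg1_flip f j x : (fdeg f <= 1)%N ->
  f x - f (flip j x) = 2 * fcoef f [set j] * sgnb (x j).
Proof.
move=> f1; rewrite (fourier_inversion f x) (fourier_inversion f (flip j x)) -sumrB.
rewrite (bigD1 [set j]) //= big1 => [|S Sj].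
  by rewrite chi_flip finset.set11 /chi big_set1; ring.
rewrite chi_flip; case: ifP => jS; last by rewrite mul1r subrr.
rewrite fcoef_gt_deg ?mul0r ?subrr // (leq_ltn_trans f1) //.
rewrite ltnNge; apply: contra Sj => S1.
by rewrite eq_sym eqEcard finset.sub1set jS cards1.
Qed.

End fourier.

(** * Sign-valued functions of degree at most one *)

Lemma fdeg1_sgnb (R : realFieldType) (n : nat) (b : cube n -> bool) :
  (fdeg (fun z => sgnb (b z) : R) <= 1)%N ->
  (exists c : R, forall z, sgnb (b z) = c) \/
  (exists j (s : R), (s = 1 \/ s = -1) /\ forall z, sgnb (b z) = s * sgnb (z j)).
Proof.
set f := fun z => _ => f1.
have fpm z : f z = 1 \/ f z = -1 by rewrite /f /sgnb; case: (b z); [right|left].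
have f_high (S : {set 'I_n}) : (1 < #|S|)%N -> fcoef f S = 0.
  by move=> S1; rewrite fcoef_gt_deg // (leq_ltn_trans f1).
have [/existsP[j cj]|] := boolP [exists j, fcoef f [set j] != 0]; last first.
  rewrite negb_exists => /forallP c0; left; exists (fcoef f finset.set0) => z.
  rewrite -/(f z) (fourier_inversion f) (bigD1 finset.set0) //= big1 => [|S S0].
    by rewrite /chi big_set0 mulr1 addr0.
  have [/f_high ->|S1] := ltnP 1 #|S|; first by rewrite mul0r.
  have /cards1P[i ->] : #|S| == 1%N by rewrite eqn_leq S1 card_gt0.
  by have := c0 i; rewrite negbK => /eqP ->; rewrite mul0r.
(* Two values in {-1,1} with nonzero difference are opposite. *)
have flipN i z : fcoef f [set i] != 0 -> f (flip i z) = - f z.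
  move=> ci; have := fdeg1_flip f i z f1.
  have : 2 * fcoef f [set i] * sgnb (z i) != 0.
    rewrite mulf_neq0 ?(mulf_neq0 _ ci) ?pnatr_eq0 // /sgnb.
    by case: (z i); rewrite ?oppr_eq0 oner_eq0.
  move/eqP; move: (2 * _ * _) => u.
  by have [->|->] := fpm z; have [->|->] := fpm (flip i z) => ? ?; lra.
(* The difference across [j] does not depend on the coordinate [i], yet flipping [i] would negate
   it; being nonzero, it cannot do both. *)
have c_other i : i != j -> fcoef f [set i] = 0.
  move=> ij; apply/eqP; apply/negPn/negP => ci.
  pose z : cube n := [ffun=> false].
  have := fdeg1_flip f j (flip i z) f1.
  rewrite flip_other 1?eq_sym // -(fdeg1_flip f j z f1) !flipN //.
  by have [->|->] := fpm z; lra.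
have fE z : f z = fcoef f finset.set0 + fcoef f [set j] * sgnb (z j).
  rewrite (fourier_inversion f) (bigD1 finset.set0) //= (bigD1 [set j]) /=; last first.
    by rewrite -card_gt0 cards1.
  rewrite big1 => [|S /andP[S0 Sj]]; first by rewrite /chi big_set0 big_set1 mulr1 addr0.
  have [/f_high ->|S1] := ltnP 1 #|S|; first by rewrite mul0r.
  have /cards1P[i Si] : #|S| == 1%N by rewrite eqn_leq S1 card_gt0.
  rewrite Si c_other ?mul0r //; apply: contraNneq Sj => <-; exact/eqP.
right; exists j, (fcoef f [set j]).
(* At this point every coordinate is 1. The opposite values here and across [j] force the constant
   coefficient to vanish. *)
pose z : cube n := [ffun=> false].
have := fE z; have := fE (flip j z); rewrite flipN // flip_same /z ffunE /= => h1 h2.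
have c0 : fcoef f finset.set0 = 0 by lra.
split; last by move=> y; rewrite -/(f y) fE c0 add0r.
by have [h|h] := fpm z; [left|right]; move: h1 h2; rewrite h; lra.
Qed.

Lemma signed_perm_of_fdeg1 (R : realFieldType) (d : nat) (T : cube d -> cube d) :
  bijective T -> (forall j, (fdeg (fun z => sgnb (T z j) : R) <= 1)%N) ->
  exists (sigma : 'S_d) (s : 'I_d -> R),
    (forall j, s j = 1 \/ s j = -1) /\
    (forall j z, sgnb (T z j) = s j * sgnb (z (sigma j))).
Proof.
move=> [T' _ TK] T1.
have coord j : exists i : 'I_d * R, (i.2 = 1 \/ i.2 = -1) /\
    forall z, sgnb (T z j) = i.2 * sgnb (z i.1).
  have [[c cP]|[i [s iP]]] := fdeg1_sgnb _ _ (fun z => T z j) (T1 j); last by exists (i, s).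
  (* By surjectivity each coordinate of [T] takes both signs, so it is not constant. *)
  have := cP (T' [ffun=> false]); rewrite -(cP (T' [ffun=> true])) !TK !ffunE /=.
  by move=> ?; exfalso; lra.
have [i iP] := choice coord.
have iI : injective (fun j => (i j).1).
  move=> j1 j2 /= i12; apply/eqP/negPn/negP => j12.
  have [_ t1] := iP j1; have [_ t2] := iP j2.
  (* Two outputs reading the same input coordinate would agree up to a fixed sign, but they are
     equal at one of these two targets and opposite at the other. *)
  have := t1 (T' [ffun=> false]); have := t2 (T' [ffun=> false]).
  have := t1 (T' [ffun j => j == j1]); have := t2 (T' [ffun j => j == j1]).
  rewrite -i12 !TK !ffunE eqxx eq_sym (negbTE j12) /sgnb.
  by case: (T' _ _); case: (T' _ _); lra.
exists (perm iI), (fun j => (i j).2); split=> j; first exact: (iP j).1.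
by move=> z; rewrite permE (iP j).2.
Qed.

(** * Mean degree of a random task after a change of coordinates *)

Section tasks.
Context {R : realType} {V : seq R} {d : nat}.
Context (Vm1 : -1 \in V) (V1 : 1 \in V).

Definition coord_task (j : 'I_d) : Ftask V d :=
  [ffun z : cube d => if z j then SeqSub Vm1 else SeqSub V1].

Lemma val_coord_task j z : val (coord_task j z) = sgnb (z j).
Proof. by rewrite ffunE; case: (z j). Qed.

Lemma mem_Fk (k : nat) (h : Ftask V d) :
  (h \in Fk V d k) = (fdeg (fun z => val (h z)) <= k)%N.
Proof. by rewrite inE. Qed.

Lemma coord_task_Fk j k : (0 < k)%N -> coord_task j \in Fk V d k.
Proof.
move=> k0; rewrite mem_Fk; apply: leq_trans k0.
by under eq_fun do rewrite val_coord_task; exact: fdeg_coord.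
Qed.

Definition precomp (tau : cube d -> cube d) (h : Ftask V d) : Ftask V d :=
  [ffun z => h (tau z)].

(** When [tau] inverts [Phi] composed with [psi], this is the degree of the unique [g] that solves
    the task [h] through [Phi]. *)
Definition deg_after (tau : cube d -> cube d) (h : Ftask V d) : nat :=
  fdeg (fun z => val (h (tau z))).

Lemma deg_afterE tau h : deg_after tau h = deg_after id (precomp tau h).
Proof. by congr fdeg; apply/funext => z; rewrite ffunE. Qed.

Lemma precomp_inj (tau : cube d -> cube d) : bijective tau -> injective (precomp tau).
Proof.
move=> [tau' _ tK] h1 h2 /ffunP h12; apply/ffunP => z.
by have := h12 (tau' z); rewrite !ffunE tK.
Qed.

Lemma leq_sum_deg_after tau (k : nat) : bijective tau ->
  (\sum_(h in Fk V d k) deg_after id h + #|precomp tau @: Fk V d k :\: Fk V d k|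
   <= \sum_(h in Fk V d k) deg_after tau h)%N.
Proof.
move=> /precomp_inj tauI; under [leqRHS]eq_bigr do rewrite deg_afterE.
by apply: (sum_leq_sum_inj _ _ _ k) => // h; rewrite mem_Fk.
Qed.

Context (p : 'I_d -> R).

Definition mean_deg (tau : cube d -> cube d) : R :=
  \sum_t taskpmf p t * (deg_after tau t.2)%:R.

Lemma mean_degE tau : mean_deg tau =
  \sum_k p k * #|Fk V d k.+1|%:R^-1 * (\sum_(h in Fk V d k.+1) deg_after tau h)%:R.
Proof.
rewrite /mean_deg -(pair_bigA _ (fun k h => taskpmf p (k, h) * (deg_after tau h)%:R)) /=.
apply: eq_bigr => k _; rewrite natr_sum mulr_sumr [RHS]big_mkcond /=.
by apply: eq_bigr => h _; rewrite /taskpmf /=; case: ifP; rewrite ?mulr0 ?mul0r.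
Qed.

Lemma signed_perm_of_mean_deg_min (T : cube d -> cube d) (tau : cube d -> cube d) :
  (0 < d)%N -> (forall k, 0 < p k) -> cancel T tau -> cancel tau T ->
  mean_deg tau <= mean_deg id ->
  exists (sigma : 'S_d) (s : 'I_d -> R),
    (forall j, s j = 1 \/ s j = -1) /\
    (forall j z, sgnb (T z j) = s j * sgnb (z (sigma j))).
Proof.
move=> d0 p0 TK tauK; rewrite !mean_degE.
have tau_bij : bijective tau by exists T.
pose c k : R := p k * #|Fk V d k.+1|%:R^-1.
pose S (ta : cube d -> cube d) (k : 'I_d) : nat :=
  (\sum_(h in Fk V d k.+1) deg_after ta h)%N.
(* The set [Fk] contains the coordinates, so its cardinal is positive and its inverse is a genuine
   weight. *)
have c0 k : 0 < c k.
  rewrite mulr_gt0 // invr_gt0 ltr0n; apply/card_gt0P.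
  by exists (coord_task k); exact: coord_task_Fk.
have S_le k : (S id k <= S tau k)%N.
  by apply: leq_trans (leq_sum_deg_after _ k.+1 tau_bij); rewrite leq_addr.
(* Indices are shifted by one: [k0] stands for tasks of degree at most 1. *)
pose k0 := Ordinal d0.
rewrite -/(c _) (bigD1 k0) //= [leRHS](bigD1 k0) //= => mean_le.
(* All the other terms can only grow from [id] to [tau], so the term at [k0] cannot. *)
have S0_le : (S tau k0 <= S id k0)%N.
  rewrite -(ler_nat R) -(ler_pM2l (c0 k0)) -(lerD2r (\sum_(k | k != k0) c k * (S id k)%:R)).
  apply: le_trans mean_le; rewrite lerD2l; apply: ler_sum => k _.
  by rewrite ler_pM2l // ler_nat.
have /eqP : #|precomp tau @: Fk V d 1 :\: Fk V d 1| == 0%N.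
  have := leq_trans (leq_sum_deg_after _ 1 tau_bij) S0_le.
  by rewrite -[leqRHS]addn0 leq_add2l leqn0.
move=> /cards0_eq/eqP; rewrite finset.setD_eq0 => sub.
have Fk_stable : precomp tau @: Fk V d 1 = Fk V d 1.
  by apply/eqP; rewrite eqEcard sub card_imset ?leqnn //; exact: precomp_inj.
apply: signed_perm_of_fdeg1; first by exists tau.
(* By stability the coordinate [z_j] equals [h (tau z)] for some [h] of degree at most 1;
   substituting [T z] for [z] gives [T_j = h]. *)
move=> j; have := coord_task_Fk j 1 isT; rewrite -Fk_stable => /imsetP[h].
rewrite mem_Fk => h1 ej; rewrite (_ : (fun z => _) = (fun z => val (h z))) //.
apply/funext => z; rewrite -val_coord_task ej ffunE TK //.
Qed.

End tasks.

Arguments mean_deg {R} V {d} p tau.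

Local Open Scope classical_set_scope.

(** * Strong law of large numbers for finitely valued variables *)

(** From [1 - u <= expR (- u)] one gets [expR u <= 1 / (1 - u)], and [(1 + u + 2 u^2) (1 - u) = 1 +
    u^2 (1 - 2 u)] is at least 1. *)
Lemma expR_le_quad (R : realType) (u : R) :
  `|u| <= 2^-1 -> expR u <= 1 + u + 2 * u ^+ 2.
Proof.
rewrite ler_norml => /andP[u1 u2].
have h : 1 - u <= (expR u)^-1 by rewrite -expRN expR_ge1Dx.
have h1 : 0 < 1 - u by lra.
have -> : expR u = ((expR u)^-1)^-1 by rewrite invrK.
apply: (@le_trans _ _ (1 - u)^-1).
  by rewrite lef_pV2 // posrE (lt_le_trans h1 h).
rewrite -[leLHS]mul1r ler_pdivrMr //.
have : 0 <= u ^+ 2 * (1 - 2 * u) by rewrite mulr_ge0 ?sqr_ge0 //; lra.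
by lra.
Qed.

(** The moment generating function is 1 at 0 with negative slope there, so it dips below 1. *)
Lemma sum_expR_lt1 (R : realType) (A : finType) (q f : A -> R) :
  (forall a, 0 <= q a) -> \sum_a q a = 1 -> \sum_a q a * f a < 0 ->
  exists2 t : R, 0 < t & \sum_a q a * expR (t * f a) < 1.
Proof.
move=> q0 q1 fneg.
have [e e0 qf] : exists2 e : R, 0 < e & \sum_a q a * f a = - e.
  by exists (- \sum_a q a * f a); rewrite ?opprK ?oppr_gt0.
pose B := 1 + e + \sum_a `|f a|.
have S0 : 0 <= \sum_a `|f a| by apply: sumr_ge0.
have B1 : 1 <= B by rewrite /B; lra.
have eB : e <= B by rewrite /B; lra.
have fB a : `|f a| <= B.
  rewrite /B (bigD1 a) //=.
  have : 0 <= \sum_(i | i != a) `|f i| by apply: sumr_ge0.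
  by move=> ?; lra.
have B0 : 0 < B by lra.
(* The bound on [t * B] puts [t * f a] in the range of the quadratic estimate; [t * B ^+ 2 = e / 4]
   keeps the remainder at most [t * e / 2], half of the linear gain [t * e]. *)
have [t [t0 tB tB2]] : exists t : R, [/\ 0 < t, t * B <= 4^-1 & t * B ^+ 2 = e / 4].
  exists (e / (4 * B ^+ 2)); split; first by rewrite divr_gt0 // mulr_gt0 // exprn_gt0.
    rewrite mulrAC ler_pdivrMr ?mulr_gt0 ?exprn_gt0 //.
    have : e * B <= B ^+ 2 by rewrite expr2 ler_pM2r.
    by rewrite mulrA mulVf ?mul1r.
  by field; rewrite gt_eqF.
exists t => //.
apply: (@le_lt_trans _ _ (\sum_a (q a + t * (q a * f a) + q a * (t * e / 2)))).
  apply: ler_sum => a _.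
  have -> : q a + t * (q a * f a) + q a * (t * e / 2)
          = q a * (1 + t * f a + t * e / 2) by ring.
  apply: ler_wpM2l => //.
  have tf : `|t * f a| <= 2^-1.
    rewrite normrM gtr0_norm //.
    have : t * `|f a| <= t * B by rewrite ler_pM2l.
    by lra.
  apply: (le_trans (expR_le_quad _ _ tf)).
  rewrite lerD2l.
  have f2 : f a ^+ 2 <= B ^+ 2 by rewrite -real_normK ?num_real // lerXn2r // nnegrE ltW.
  have : t ^+ 2 * f a ^+ 2 <= t ^+ 2 * B ^+ 2 by rewrite ler_pM2l ?exprn_gt0.
  have -> : t ^+ 2 * B ^+ 2 = t * (t * B ^+ 2) by ring.
  by rewrite tB2 [(t * f a) ^+ 2]exprMn; lra.
rewrite !big_split /= q1 -mulr_sumr -mulr_suml q1 mul1r qf.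
have : 0 < t * e by rewrite mulr_gt0.
by lra.
Qed.

Section iid.
Context {disp : measure_display} {T : measurableType disp} {R : realType}
  {A : finType} {P : probability T R} {X : nat -> T -> A} {q : A -> R}.
Context (HX : iid_with_pmf P X q).

Lemma iid_measure1 i a : P (X i @^-1` [set a]) = (q a)%:E.
Proof.
have := HX.2 [:: i] (fun=> a) isT; rewrite big_seq1 /= => <-; congr (P _).
apply/seteqP; split=> [w wa j|w /(_ i)].
  by rewrite /= mem_seq1 => /eqP ->.
by apply; rewrite /= mem_seq1.
Qed.

Lemma pmf_ge0 a : 0 <= q a.
Proof. by rewrite -lee_fin -(iid_measure1 0) measure_ge0. Qed.

Lemma pmf_sum1 : \sum_a q a = 1.
Proof.
have tr : trivIset [set` index_enum A] (fun a => X 0 @^-1` [set a]).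
  apply/trivIsetP => a b _ _ /eqP ab; apply/seteqP; split => // w [/= wa wb].
  by case: ab; rewrite -wa -wb.
have := measure_fin_bigcup P finite_finset tr (fun a _ => HX.1 0%N a).
rewrite -fsbig_seq ?index_enum_uniq // (_ : \bigcup_(i in _) _ = setT); last first.
  by apply/seteqP; split => // w _; exists (X 0 w); rewrite //= mem_index_enum.
move=> P1; apply: EFin_inj; rewrite -sumEFin -[RHS](probability_setT P).
apply/esym/(etrans P1).
by apply: eq_bigr => a _; exact: iid_measure1.
Qed.

(** The cylinder prescribing the first [n + 1] variables; with [n + 1] the type of indices is
    inhabited, as [inord] requires. *)
Let C n (a : {ffun 'I_n.+1 -> A}) : set T :=
  \bigcap_(i in [set j | j \in iota 0 n.+1]) (X i @^-1` [set a (inord i)]).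

Let mC n a : measurable (@C n a).
Proof.
apply: fin_bigcap_measurable => [|i _]; last exact: HX.1.
exact: finite_seq.
Qed.

Let PC n a : P (@C n a) = (\prod_i q (a i))%:E.
Proof.
rewrite /C (HX.2 _ (fun i => a (inord i))) ?iota_uniq //; congr (_%:E).
rewrite (_ : iota 0 n.+1 = index_iota 0 n.+1) ?big_mkord; last by rewrite /index_iota subn0.
by apply: eq_bigr => i _; rewrite inord_val.
Qed.

Lemma measure_bigsetU_le (I : Type) (s : seq I) (Q : pred I) (F : I -> set T) :
  (forall i, measurable (F i)) ->
  (P (\big[setU/set0]_(i <- s | Q i) F i) <= \sum_(i <- s | Q i) P (F i))%E.
Proof.
move=> mF; elim: s => [|i s ih]; first by rewrite !big_nil measure0.
rewrite !big_cons; case: ifP => // _.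
apply: (le_trans (measureU2 _ _ _)) => //; first exact: bigsetU_measurable.
by rewrite leeD2l.
Qed.

(* Chernoff's bound makes the probabilities of [0 <= f(X_0) + .. + f(X_n)]
   summable, so Borel-Cantelli applies. *)
Lemma ae_eventually_sum_lt0 (f : A -> R) : \sum_a q a * f a < 0 ->
  {ae P, forall w, \forall n \near \oo, \sum_(i < n) f (X i w) < 0}.
Proof.
move=> fneg.
have [t t0 M1] := sum_expR_lt1 _ _ q f pmf_ge0 pmf_sum1 fneg.
set M := \sum_a _ in M1.
have M0 : 0 <= M by apply: sumr_ge0 => a _; rewrite mulr_ge0 ?pmf_ge0 ?expR_ge0.
(* Writing the event as a finite union of cylinders gives its measurability and a union bound. *)
pose F n := \big[setU/set0]_(a : {ffun 'I_n.+1 -> A} | 0 <= \sum_i f (a i)) @C n a.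
have mF n : measurable (F n) by exact: bigsetU_measurable.
have PF n : (P (F n) <= (M ^+ n.+1)%:E)%E.
  apply: (le_trans (measure_bigsetU_le _ _ _ _ _)) => //.
  under eq_bigr do rewrite PC.
  rewrite sumEFin lee_fin.
  have -> : M ^+ n.+1 = \sum_(a : {ffun 'I_n.+1 -> A}) \prod_i (q (a i) * expR (t * f (a i))).
    transitivity (\prod_(i < n.+1) \sum_a q a * expR (t * f a)).
      by rewrite prodr_const card_ord.
    exact: bigA_distr_bigA.
  (* Markov's step: the exponential factor is at least 1 on words with nonnegative sum. *)
  rewrite big_mkcond /=; apply: ler_sum => a _.
  have q0 : 0 <= \prod_i q (a i) by apply: prodr_ge0 => i _; exact: pmf_ge0.
  rewrite big_split /= -expR_sum -mulr_sumr.
  case: ifP => [s0|_]; last by rewrite mulr_ge0 ?expR_ge0.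
  rewrite ler_peMr // -expR0 ler_expR mulr_ge0 // ltW //.
have sF : (\big[+%E/0%R]_(0 <= n <oo) P (F n) < +oo)%E.
  apply: (@le_lt_trans _ _ (\big[+%E/0%R]_(0 <= n <oo) (geometric M M n)%:E)%E).
    by apply: lee_nneseries => [n _ _|n _]; [exact: measure_ge0|rewrite /= -exprS].
  have cv : cvgn (series (geometric M M)).
    by apply: is_cvg_geometric_series; rewrite ger0_norm.
  have -> : (\big[+%E/0%R]_(0 <= n <oo) (geometric M M n)%:E)%E
      = (limn (series (geometric M M)))%:E.
    rewrite -EFin_lim //; congr (limn _); apply/funext => n /=.
    by rewrite /series /= sumEFin.
  exact: ltry.
have /negligibleP P0 := lim_sup_set_cvg0 mF sF.
have mL : measurable (lim_sup_set F).
  by apply: bigcapT_measurable => n; apply: bigcup_measurable.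
apply: negligibleS (P0 mL) => w /= Hw n _.
(* [F k] concerns [k + 1] variables, hence the threshold [n + 1] on their number. *)
apply: contrapT => Hn; apply: Hw; exists n.+1 => // -[//|k] /= nk.
rewrite ltNge; apply/negP => s0; apply: Hn; exists k => //=.
pose a := [ffun i : 'I_k.+1 => X i w].
rewrite /F (bigD1 a) /=; last by under eq_bigr do rewrite ffunE.
left => i; rewrite /mkset mem_iota add0n => /andP[_ ik].
by rewrite /= /a ffunE inordK.
Qed.

Lemma slln (f : A -> R) : {ae P, forall w,
  (fun n : nat => n%:R^-1 * \sum_(i < n) f (X i w)) @ \oo --> \sum_a q a * f a}.
Proof.
set E := \sum_a _.
(* Both centred functions have mean [- e], which traps the average within [e] of [E]. *)
have H (e : R) : 0 < e -> {ae P, forall w, \forall n \near \oo,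
    \sum_(i < n) (f (X i w) - (E + e)) < 0 /\
    \sum_(i < n) ((E - e) - f (X i w)) < 0}.
  move=> e0.
  have /ae_eventually_sum_lt0 h1 : \sum_a q a * (f a - (E + e)) < 0.
    under eq_bigr do rewrite mulrBr.
    by rewrite sumrB -mulr_suml pmf_sum1 mul1r -/E; lra.
  have /ae_eventually_sum_lt0 h2 : \sum_a q a * (E - e - f a) < 0.
    under eq_bigr do rewrite mulrBr.
    by rewrite sumrB -mulr_suml pmf_sum1 mul1r -/E; lra.
  by apply: filterS2 h1 h2 => w; apply: filterS2.
(* Only countably many tolerances are used, so the exceptional sets together remain null. *)
have /ae_foralln K := fun k => H k.+1%:R^-1 ltac:(by []).
apply: filterS K => w K; apply/cvgrPdist_lt => e e0.
have [k ke] : exists k : nat, k.+1%:R^-1 < e.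
  by have [k] := ltr_add_invr e0; rewrite add0r; exists k.
near=> n.
have n0 : (0 < n)%N by near: n; exact: nbhs_infty_gt.
have [] : \sum_(i < n) (f (X i w) - (E + k.+1%:R^-1)) < 0 /\
    \sum_(i < n) ((E - k.+1%:R^-1) - f (X i w)) < 0 by near: n; exact: K.
have sc (c : R) : \sum_(i < n) c = n%:R * c.
  by rewrite sumr_const card_ord mulr_natl.
rewrite !sumrB !sc => h1 h2.
have n0R : 0 < n%:R :> R by rewrite ltr0n.
apply: le_lt_trans ke; rewrite -(ler_pM2l n0R) -[X in X * `|_|]gtr0_norm // -normrM.
rewrite mulrBr mulrA divff ?gt_eqF // mul1r ler_norml.
move: (\sum_(i < n) _) (k.+1%:R^-1) h1 h2 => S x h1 h2.
by apply/andP; split; lra.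
Unshelve. all: by end_near.
Qed.

End iid.

(** * Convergence of the objective and its minimizers *)

Theorem theorem4 (R : realType) (m d : nat) (V : seq R)
  (psi : cube d -> cube m) (p : 'I_d -> R)
  (disp : measure_display) (T : measurableType disp) (P : probability T R)
  (X : nat -> T -> ('I_d * Ftask V d)%type) :
  (1 <= d)%N -> (d <= m)%N -> injective psi ->
  -1 \in V -> 1 \in V ->
  (forall k, 0 < p k < 1) -> \sum_(k < d) p k = 1 ->
  iid_with_pmf P X (taskpmf p) ->
  {ae P, forall w,
    exists L : (cube m -> cube d) -> R,
      (forall Phi, valid_rep psi Phi ->
         forall g : nat -> cube d -> R,
           (forall i z, g i (Phi (psi z)) = val ((X i w).2 z)) ->
           (fun n : nat => @objective R m d n Phi g) @ \oo --> (L Phi : R)) /\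
      (forall Phis, valid_rep psi Phis ->
         (forall Phi, valid_rep psi Phi -> L Phis <= L Phi) ->
         exists (sigma : 'S_d) (s : 'I_d -> R),
           (forall j, s j = 1 \/ s j = -1) /\
           (forall j z, sgnb (Phis (psi z) j) = s j * sgnb (z (sigma j))))}.
Proof.
move=> d0 _ psiI Vm1 V1 p01 _ HX.
pose inv (Phi : cube m -> cube d) : {ffun cube d -> cube d} :=
  [ffun y => finv (fun z => Phi (psi z)) y].
(* The maps [tau] form a finite type, so one null set serves all representations. *)
have : {ae P, forall w, forall tau : {ffun cube d -> cube d},
    (fun n : nat => n%:R^-1 * \sum_(i < n) (deg_after tau (X i w).2)%:R)
      @ \oo --> (mean_deg V p tau : R)}.
  have slln_tau (tau : {ffun cube d -> cube d}) := slln HX (fun t => (deg_after tau t.2)%:R).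
  exact: (filter_forall _ slln_tau).
apply: filterS => w cv; exists (fun Phi => mean_deg V p (inv Phi)).
have invK Phi : valid_rep psi Phi ->
    cancel (fun z => Phi (psi z)) (inv Phi) /\ cancel (inv Phi) (fun z => Phi (psi z)).
  move=> /bij_inj PhiI; split=> z; rewrite ffunE; first exact: finv_f.
  exact: (f_finv PhiI).
split=> [Phi Phiv g gE|Phis Phisv Lmin].
  have [PhiK invKPhi] := invK Phi Phiv.
  have gd i : fdeg (g i) = deg_after (inv Phi) (X i w).2.
    by congr fdeg; apply/funext => y; rewrite -gE invKPhi.
  (* The cost of the representation is independent of [n], so it vanishes after division by [n]. *)
  set K : R := \sum_(j < d) (fdeg (fun x => sgnb (R:=R) (Phi x j)))%:R.
  rewrite (_ : (fun n => _) = (fun n : nat =>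
      n%:R^-1 * \sum_(i < n) (deg_after (inv Phi) (X i w).2)%:R + n%:R^-1 * K)); last first.
    apply/funext => n; rewrite /objective mulrDr; congr (_ * _ + _).
    by apply: eq_bigr => i _; rewrite gd.
  have K_cv : (fun n : nat => n%:R^-1 * K) @ \oo --> (0 : R).
    rewrite -[X in _ --> X](mul0r K); apply: cvgMl.
    by rewrite -(cvg_shiftS (fun n : nat => n%:R^-1 : R)); exact: cvg_harmonic.
  rewrite -[mean_deg _ _ _]addr0; exact: cvgD (cv (inv Phi)) K_cv.
(* The competitor is a left inverse of [psi], with an arbitrary value off its image; its change of
   coordinates is the identity. *)
pose Phi0 (x : cube m) : cube d := odflt [ffun=> false] [pick z | psi z == x].
have Phi0K z : Phi0 (psi z) = z.
  by rewrite /Phi0; case: pickP => [z' /eqP/psiI //|/(_ z)]; rewrite eqxx.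
have Phi0v : valid_rep psi Phi0 by exists id => z; rewrite /= Phi0K.
have [K1 K2] := invK _ Phisv.
apply: (signed_perm_of_mean_deg_min Vm1 V1 p (fun z => Phis (psi z)) (inv Phis)) => //.
  by move=> k; have /andP[] := p01 k.
apply: le_trans (Lmin _ Phi0v) _.
rewrite (_ : (inv Phi0 : cube d -> cube d) = id) //.
apply/funext => z; rewrite -[in LHS](Phi0K z).
by have [-> _] := invK _ Phi0v.
Qed.
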